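(* For any $n\in\mathbb N\cup\{\infty\}$, there exists (for some field and some parameters $\alpha,\beta$) a symmetric $2$-generated $\mathcal M(\alpha,\beta)$-axial algebra with axet $X(n)$.
   Context: Algebras are commutative, not necessarily associative, over a field $\mathbb F$ of characteristic not $2$. $A_\lambda(a)=\{v\in A: av=\lambda v\}$. For $\alpha,\beta\in\mathbb F$ with $1,0,\alpha,\beta$ pairwise distinct, the fusion law $\mathcal M(\alpha,\beta)$ is the set $\{1,0,\alpha,\beta\}$ with the symmetric operation $1\star1=\{1\}$, $1\star0=\emptyset$, $1\star\alpha=\{\alpha\}$, $1\star\beta=\{\beta\}$, $0\star0=\{0\}$, $0\star\alpha=\{\alpha\}$, $0\star\beta=\{\beta\}$, $\alpha\star\alpha=\{1,0\}$, $\alpha\star\beta=\{\beta\}$, $\beta\star\beta=\{1,0,\alpha\}$. An $\mathcal M(\alpha,\beta)$-axis in $A$ is an idempotent $a$ with $A=\bigoplus_{\lambda\in\{1,0,\alpha,\beta\}}A_\lambda(a)$ and $A_\lambda(a)A_\mu(a)\subseteq\bigoplus_{\nu\in\lambda\star\mu}A_\nu(a)$. An $\mathcal M(\alpha,\beta)$-axial algebra is an algebra generated by a set of such axes; it is $2$-generated if it is generated by two axes $a,b$, and then it is symmetric if it has an involutory automorphism switching $a$ and $b$. The Miyamoto involution $\tau_a\in\mathrm{Aut}(A)$ of an axis $a$ acts as $-1$ on $A_\beta(a)$ and as $1$ on $A_1(a)\oplus A_0(a)\oplus A_\alpha(a)$. A $C_2$-axet $(G,X,\tau)$ is a group $G$,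 a $G$-set $X$ and a map $x\mapsto\tau_x\in G_x$ with $\tau_x^2=1$ and $\tau_{xg}=g^{-1}\tau_xg$ for all $x\in X$, $g\in G$. An isomorphism of $C_2$-axets $X\to X'$ is a bijection $\psi$ with $\psi(y\tau_x)=\psi(y)\tau'_{\psi(x)}$ for all $x,y\in X$. The axet of $A$ generated by axes $a,b$ is $X(A)=a^{\mathrm{Miy}(A)}\cup b^{\mathrm{Miy}(A)}$, where $\mathrm{Miy}(A)=\langle\tau_a,\tau_b\rangle$, with $G$ the setwise stabiliser of $X(A)$ in $\mathrm{Aut}(A)$ and $x\mapsto \tau_x$ the Miyamoto involution; ''$A$ has axet $X(n)$'' means $X(A)\cong X(n)$. The axet $X(n)$: for $n$ finite it is $\mathbb Z/n\mathbb Z$ (vertices of the $n$-gon) with $G=D_{2n}$ of order $2n$ and $\tau_i\colon j\mapsto 2i-j$; $X(\infty)=\mathbb Z$ with $G=D_\infty$ and $\tau_i\colon j\mapsto 2i-j$. *)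

(* Defs.v *)
From HB Require Import structures.
From mathcomp Require Import all_boot all_algebra.
From mathcomp Require Import boolp classical_sets.

Set Implicit Arguments.
Unset Strict Implicit.
Unset Printing Implicit Defensive.

Import GRing.Theory.
Local Open Scope ring_scope.
Local Open Scope classical_set_scope.

(* Commutative, not necessarily associative or unital, algebras. *)
Record comAlgebra (F : fieldType) := ComAlgebra {
  alg_space :> lmodType F;
  amul : {bilinear alg_space -> alg_space -> alg_space};
  amulC : commutative amul }.
Arguments amul {F c}.
Arguments amulC {F c}.

Section Automorphisms.
Variables (F : fieldType) (A : comAlgebra F).

Record aut := Aut {
  aut_fun :> A -> A;
  aut_linear : linear aut_fun;
  autM : {morph aut_fun : x y / amul x y};
  aut_bij : bijective aut_fun }.

Lemma autP (f g : aut) : f =1 g -> f = g.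
Proof.
case: f => f lf mf bf; case: g => g lg mg bg /= /funext fg; subst g.
by congr Aut; apply: Prop_irrelevance.
Qed.

Lemma aut_inv_subproof (f : aut) : exists g : aut, cancel f g /\ cancel g f.
Proof.
case: (aut_bij f) => g fK gK.
have lg : linear g.
  by move=> c x y; apply: (can_inj fK); rewrite gK aut_linear !gK.
have mg : {morph g : x y / amul x y}.
  by move=> x y; apply: (can_inj fK); rewrite gK autM !gK.
by exists (Aut lg mg (Bijective gK fK)).
Qed.

Definition aut_one : aut :=
  Aut (fun _ _ _ => erefl) (fun _ _ => erefl) (Bijective (frefl id) (frefl id)).

Lemma aut_mul_linear (f g : aut) : linear (g \o f).
Proof. by move=> c x y /=; rewrite !aut_linear. Qed.

Lemma aut_mulM (f g : aut) : {morph g \o f : x y / amul x y}.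
Proof. by move=> x y /=; rewrite !autM. Qed.

(* Automorphisms act on the right: f * g is f followed by g. *)
Definition aut_mul (f g : aut) : aut :=
  Aut (aut_mul_linear f g) (aut_mulM f g) (bij_comp (aut_bij g) (aut_bij f)).

Definition aut_inv (f : aut) : aut := sval (cid (aut_inv_subproof f)).

Lemma autK (f : aut) : cancel f (aut_inv f).
Proof. by rewrite /aut_inv; case: cid => g []. Qed.

Lemma autVK (f : aut) : cancel (aut_inv f) f.
Proof. by rewrite /aut_inv; case: cid => g []. Qed.

Lemma aut_mulA : associative aut_mul.
Proof. by move=> f g h; apply: autP. Qed.
Lemma aut_mul1 : left_id aut_one aut_mul.
Proof. by move=> f; apply: autP. Qed.
Lemma aut_mulr1 : right_id aut_one aut_mul.
Proof. by move=> f; apply: autP. Qed.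
Lemma aut_mulV : left_inverse aut_one aut_inv aut_mul.
Proof. by move=> f; apply: autP => x /=; rewrite autVK. Qed.
Lemma aut_mulrV : right_inverse aut_one aut_inv aut_mul.
Proof. by move=> f; apply: autP => x /=; rewrite autK. Qed.

HB.instance Definition _ := gen_eqMixin aut.
HB.instance Definition _ := gen_choiceMixin aut.
HB.instance Definition _ :=
  isGroup.Build aut aut_mulA aut_mul1 aut_mulr1 aut_mulV aut_mulrV.

Lemma aut1E x : (1%g : aut) x = x. Proof. by []. Qed.
Lemma autME (f g : aut) x : (f * g)%g x = g (f x). Proof. by []. Qed.
Lemma autVE (f : aut) x : (f^-1)%g (f x) = x. Proof. exact: autK. Qed.
Lemma autEV (f : aut) x : f ((f^-1)%g x) = x. Proof. exact: autVK. Qed.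

Lemma aut0 (f : aut) : f 0 = 0.
Proof.
have := aut_linear f 1 0 0; rewrite !scale1r addr0 => /eqP.
by rewrite -subr_eq0 opprD addrA subrr sub0r oppr_eq0 => /eqP.
Qed.
Lemma autD (f : aut) : {morph f : x y / x + y}.
Proof. by move=> x y; have := aut_linear f 1 x y; rewrite !scale1r. Qed.
Lemma autZ (f : aut) c : {morph f : x / c *: x}.
Proof. by move=> x; have := aut_linear f c x 0; rewrite aut0 !addr0. Qed.
Lemma autN (f : aut) : {morph f : x / - x}.
Proof. by move=> x; rewrite -scaleN1r autZ scaleN1r. Qed.
Lemma aut_sum (f : aut) I (s : seq I) (w : I -> A) :
  f (\sum_(i <- s) w i) = \sum_(i <- s) f (w i).
Proof. exact: (big_morph f (@autD f) (aut0 f)). Qed.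

Definition subalgebra (B : set A) : Prop :=
  [/\ B 0, forall c x y, B x -> B y -> B (c *: x + y)
    & forall x y, B x -> B y -> B (amul x y)].

Definition stabset (X : set A) : {pred aut} := [pred g : aut | `[< g @` X = X >]].

Lemma stabsetP X (g : aut) : reflect (g @` X = X) (g \in stabset X).
Proof. exact: asboolP. Qed.

Lemma stabset_group_closed X : group_closed (stabset X).
Proof.
split; first by apply/stabsetP; rewrite eqEsubset; split=> [x [y Xy <-]|x Xx] //;
  exists x.
move=> f g /stabsetP fX /stabsetP gX; apply/stabsetP.
have gVX : (g^-1)%g @` X = X.
  rewrite -[in LHS]gX eqEsubset; split=> [_ [_ [x Xx <-] <-]|x Xx].
    by rewrite autVE.
  by exists (g x); [exists x | rewrite autVE].
rewrite -[RHS]gVX -[in RHS]fX eqEsubset; split=> [_ [x Xx <-]|_ [_ [x Xx <-] <-]].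
  by exists (f x) => //; exists x.
by exists x.
Qed.

(* The setwise stabiliser of X in Aut(A). *)
Record stab (X : set A) := Stab {
  stab_val : aut;
  _ : stab_val \in stabset X }.

HB.instance Definition _ X := [isSub for @stab_val X].
HB.instance Definition _ X := [Choice of stab X by <:].
HB.instance Definition _ X :=
  SubChoice_isSubGroup.Build _ _ (stab X) (stabset_group_closed X).

End Automorphisms.

Definition subgroup (G : groupType) (H : set G) : Prop :=
  [/\ H 1%g, forall x y, H x -> H y -> H (x * y)%g & forall x, H x -> H (x^-1)%g].

Record C2axet := C2Axet {
  axet_group : groupType;
  axet_point :> Type;
  axet_act : axet_point -> axet_group -> axet_point;
  axet_tau : axet_point -> axet_group;
  axet_act1 : forall x, axet_act x 1%g = x;
  axet_actM : forall x g h, axet_act x (g * h)%g = axet_act (axet_act x g) h;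
  axet_tau_fix : forall x, axet_act x (axet_tau x) = x;
  axet_tau2 : forall x, (axet_tau x * axet_tau x)%g = 1%g;
  axet_tauJ : forall x g,
    axet_tau (axet_act x g) = (g^-1 * axet_tau x * g)%g }.

Definition axet_iso (X Y : C2axet) : Prop :=
  exists2 psi : X -> Y, bijective psi &
    forall x y, psi (axet_act y (axet_tau x)) =
                axet_act (psi y) (axet_tau (psi x)).

(* Labels for the elements of the fusion law M(alpha, beta), which are given by
   Meval and are assumed to be pairwise distinct where the law is used. *)
Inductive Mlabel := M1 | M0 | Malpha | Mbeta.

Definition Mlabels : seq Mlabel := [:: M1; M0; Malpha; Mbeta].

Definition Meval (F : fieldType) (alpha beta : F) (l : Mlabel) : F :=
  match l with M1 => 1 | M0 => 0 | Malpha => alpha | Mbeta => beta end.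

Definition Mstar (l m : Mlabel) : seq Mlabel :=
  match l, m with
  | M1, M1 => [:: M1]
  | M1, M0 | M0, M1 => [::]
  | M1, Malpha | Malpha, M1 => [:: Malpha]
  | M1, Mbeta | Mbeta, M1 => [:: Mbeta]
  | M0, M0 => [:: M0]
  | M0, Malpha | Malpha, M0 => [:: Malpha]
  | M0, Mbeta | Mbeta, M0 => [:: Mbeta]
  | Malpha, Malpha => [:: M1; M0]
  | Malpha, Mbeta | Mbeta, Malpha => [:: Mbeta]
  | Mbeta, Mbeta => [:: M1; M0; Malpha]
  end.

Section Axes.
Variables (F : fieldType) (alpha beta : F) (A : comAlgebra F).
Implicit Types (a b v : A) (l m : Mlabel).

Definition eigenspace (lambda : F) a : set A := [set v | amul a v = lambda *: v].

Local Notation ev := (Meval alpha beta).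

(* The sum of the eigenspaces A_l(a), for l in s. *)
Definition eigensum (s : seq Mlabel) a : set A :=
  [set v | exists2 w : Mlabel -> A,
     forall l, eigenspace (ev l) a (w l) & v = \sum_(l <- s) w l].

Record axis a : Prop := Axis {
  axis_idem : amul a a = a;
  axis_span : eigensum Mlabels a = setT;
  axis_direct : forall w : Mlabel -> A,
    (forall l, eigenspace (ev l) a (w l)) -> \sum_(l <- Mlabels) w l = 0 ->
    forall l, w l = 0;
  axis_fusion : forall l m v v',
    eigenspace (ev l) a v -> eigenspace (ev m) a v' ->
    eigensum (Mstar l m) a (amul v v') }.

Definition is_miyamoto a (t : aut A) : Prop :=
  [/\ forall v, eigenspace beta a v -> t v = - v,
      forall v, eigenspace 1 a v -> t v = v,
      forall v, eigenspace 0 a v -> t v = v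
    & forall v, eigenspace alpha a v -> t v = v].

(* Well defined on axes: see miyamotoP and miyamoto_unique. *)
Definition miyamoto a : aut A := xget 1%g [set t | is_miyamoto a t].

Lemma eigenspace0 lambda a : eigenspace lambda a 0.
Proof. by rewrite /eigenspace/= linear0r scaler0. Qed.

Lemma eigenspaceP lambda a c v v' : eigenspace lambda a v ->
  eigenspace lambda a v' -> eigenspace lambda a (c *: v + v').
Proof.
by rewrite /eigenspace/= => av av'; rewrite linearPr av av' scalerDr !scalerA mulrC.
Qed.

Definition Msign (l : Mlabel) : F := if l is Mbeta then -1 else 1.

Lemma is_miyamotoE a t l v : is_miyamoto a t -> eigenspace (ev l) a v ->
  t v = Msign l *: v.
Proof.
by case=> tb t1 t0 ta; case: l => /= hv; rewrite ?scale1r ?scaleN1r; auto.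
Qed.

Lemma is_miyamoto_unique a t t' : axis a ->
  is_miyamoto a t -> is_miyamoto a t' -> t = t'.
Proof.
move=> aa ta t'a; apply: autP => v.
have [w wE ->] : eigensum Mlabels a v by rewrite axis_span.
rewrite !aut_sum; apply: eq_bigr => l _.
by rewrite (is_miyamotoE ta (wE l)) (is_miyamotoE t'a (wE l)).
Qed.

Lemma is_miyamoto_exists a : axis a -> exists t, is_miyamoto a t.
Proof.
move=> aa.
pose dec v w := (forall l, eigenspace (ev l) a (w l)) /\
  v = \sum_(l <- Mlabels) w l.
have decE v : exists w, dec v w.
  have [w wE ->] : eigensum Mlabels a v by rewrite axis_span.
  by exists w.
have decU v w w' : dec v w -> dec v w' -> w = w'.
  move=> [we wv] [we' wv']; apply: funext => l; apply/eqP.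
  rewrite -subr_eq0; apply/eqP.
  have := @axis_direct _ aa (fun l => w l - w' l); apply.
    by move=> k; rewrite addrC -scaleN1r; apply: eigenspaceP.
  by rewrite sumrB -wv -wv' subrr.
pose d v := sval (cid (decE v)).
have dP v : dec v (d v) by rewrite /d; case: cid.
pose t v := \sum_(l <- Mlabels) Msign l *: d v l.
have tE v w : dec v w -> t v = \sum_(l <- Mlabels) Msign l *: w l.
  by move=> vw; rewrite /t (decU _ _ _ (dP v) vw).
have tlin : linear t.
  move=> c x y; rewrite (tE _ (fun l => c *: d x l + d y l)); last first.
    case: (dP x) => ex dx; case: (dP y) => ey dy; split.
      by move=> l; apply: eigenspaceP.
    by rewrite big_split /= -scaler_sumr -dx -dy.
  rewrite /t scaler_sumr -big_split; apply: eq_bigr => l _ /=.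
  by rewrite scalerDr !scalerA mulrC.
have t0 : t 0 = 0.
  have := tlin 1 0 0; rewrite !scale1r addr0 => /eqP.
  by rewrite -subr_eq0 opprD addrA subrr sub0r oppr_eq0 => /eqP.
have tD : {morph t : x y / x + y}.
  by move=> x y; have := tlin 1 x y; rewrite !scale1r.
have tZ c : {morph t : x / c *: x}.
  by move=> x; have := tlin c x 0; rewrite t0 !addr0.
have tev l v : eigenspace (ev l) a v -> t v = Msign l *: v.
  move=> vl.
  have delta z : \sum_(k <- Mlabels)
      (match k, l with M1, M1 | M0, M0 | Malpha, Malpha | Mbeta, Mbeta => z
       | _, _ => 0 : A end) = z.
    by rewrite /Mlabels !big_cons big_nil; case: l {vl}; rewrite ?add0r ?addr0.
  rewrite (tE _ (fun k => match k, l with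
       M1, M1 | M0, M0 | Malpha, Malpha | Mbeta, Mbeta => v
       | _, _ => 0 : A end)); last first.
    split; last by rewrite delta.
    by case; case: l vl {delta} => // _; apply: eigenspace0.
  rewrite -[RHS]delta; apply: eq_bigr => k _.
  by case: k; case: l {vl delta}; rewrite ?scaler0.
have tsum s (w : Mlabel -> A) : (forall l, eigenspace (ev l) a (w l)) ->
    t (\sum_(l <- s) w l) = \sum_(l <- s) Msign l *: w l.
  move=> we; rewrite (big_morph t tD t0); apply: eq_bigr => l _.
  exact: tev.
have tK : involutive t.
  move=> v; case: (dP v) => ve {2}->; rewrite {2}/t (big_morph t tD t0).
  apply: eq_bigr => l _; rewrite tZ (tev _ _ (ve l)) scalerA.
  by case: l; rewrite /= ?mulrNN mulr1 scale1r.
have tfus l m v v' : eigenspace (ev l) a v -> eigenspace (ev m) a v' ->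
    t (amul v v') = amul (t v) (t v').
  move=> vl vm; rewrite (tev _ _ vl) (tev _ _ vm) linearZl_LR linearZr_LR scalerA.
  have [w we ->] := axis_fusion aa vl vm; rewrite tsum // scaler_sumr.
  by case: l {vl}; case: m {vm}; rewrite /= ?big_cons ?big_nil /=
     ?mulrNN ?mulr1 ?mul1r.
have suml I (s : seq I) (w : I -> A) v :
    amul (\sum_(i <- s) w i) v = \sum_(i <- s) amul (w i) v.
  exact: linear_sumlz.
have sumr I (s : seq I) (w : I -> A) v :
    amul v (\sum_(i <- s) w i) = \sum_(i <- s) amul v (w i).
  by rewrite linear_sumr.
have tM : {morph t : x y / amul x y}.
  move=> x y; case: (dP x) => ex ->; case: (dP y) => ey ->.
  rewrite suml !(big_morph t tD t0) suml; apply: eq_bigr => l _.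
  rewrite !sumr (big_morph t tD t0); apply: eq_bigr => m _.
  exact: tfus.
exists (Aut tlin tM (Bijective tK tK)).
by split=> v /= ve; [rewrite (tev Mbeta)|rewrite (tev M1)|rewrite (tev M0)
  |rewrite (tev Malpha)] => //=; rewrite ?scaleN1r ?scale1r.
Qed.

Lemma miyamotoP a : axis a -> is_miyamoto a (miyamoto a).
Proof. by move=> /is_miyamoto_exists [t tP]; apply: (xgetI _ tP). Qed.

Lemma miyamoto_unique a t : axis a -> is_miyamoto a t -> t = miyamoto a.
Proof. by move=> aa ta; apply: (is_miyamoto_unique aa ta); apply: miyamotoP. Qed.

Lemma miyamoto_fix a : axis a -> miyamoto a a = a.
Proof.
move=> aa; have [_ t1 _ _] := miyamotoP aa; apply: t1.
by rewrite /eigenspace/= axis_idem // scale1r.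
Qed.

Lemma miyamoto2 a : axis a -> (miyamoto a * miyamoto a)%g = 1%g.
Proof.
move=> aa; have ta := miyamotoP aa; apply: autP => v; rewrite autME aut1E.
have [w we ->] : eigensum Mlabels a v by rewrite axis_span.
rewrite !aut_sum; apply: eq_bigr => l _.
rewrite !(is_miyamotoE ta (we l)) autZ (is_miyamotoE ta (we l)) scalerA.
by case: l; rewrite /= ?mulrNN mulr1 scale1r.
Qed.

Lemma eigenspace_aut (g : aut A) lambda a v :
  eigenspace lambda (g a) (g v) <-> eigenspace lambda a v.
Proof.
rewrite /eigenspace/= -autM -autZ; split=> [|-> //].
exact: (bij_inj (aut_bij g)).
Qed.

Lemma eigenspace_autV (g : aut A) lambda a v :
  eigenspace lambda (g a) v <-> eigenspace lambda a ((g^-1)%g v).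
Proof. by have := eigenspace_aut g lambda a ((g^-1)%g v); rewrite autEV. Qed.

Lemma eigensum_aut (g : aut A) s a v :
  eigensum s a v -> eigensum s (g a) (g v).
Proof.
case=> w we ->; exists (fun l => g (w l)); last exact: aut_sum.
by move=> l; apply/eigenspace_aut.
Qed.

Lemma axis_aut (g : aut A) a : axis a -> axis (g a).
Proof.
move=> aa; split.
- by rewrite -autM axis_idem.
- rewrite eqEsubset; split=> // v _.
  by rewrite -(autEV g v); apply: eigensum_aut; rewrite axis_span.
- move=> w we w0 l.
  have := @axis_direct _ aa (fun k => (g^-1)%g (w k)) _ _ l.
  move=> /(_ _ _)/(congr1 g); rewrite autEV aut0; apply.
    by move=> k; apply/eigenspace_autV.
  by rewrite -aut_sum w0 aut0.
- move=> l m v v' /eigenspace_autV vl /eigenspace_autV vm.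
  rewrite -(autEV g v) -(autEV g v') -autM; apply: eigensum_aut.
  exact: axis_fusion vl vm.
Qed.

Lemma miyamotoJ (g : aut A) a : axis a ->
  miyamoto (g a) = (g^-1 * miyamoto a * g)%g.
Proof.
move=> aa; apply/esym/miyamoto_unique; first exact: axis_aut.
have [tb t1 t0 ta] := miyamotoP aa.
by split=> v /eigenspace_autV ve; rewrite !autME ?(tb _ ve) ?(t1 _ ve)
   ?(t0 _ ve) ?(ta _ ve) ?autN autEV.
Qed.

(* Miy(A) = < tau_a, tau_b > *)
Definition miy a b : set (aut A) :=
  smallest (@subgroup (aut A)) [set miyamoto a; miyamoto b].

(* X(A) = a^Miy(A) U b^Miy(A) *)
Definition axes a b : set A :=
  [set (g : aut A) a | g in miy a b] `|` [set (g : aut A) b | g in miy a b].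

Lemma miy_subgroup a b : subgroup (miy a b).
Proof.
split.
- by move=> H [[]].
- by move=> x y xP yP H HP; case: (HP) => -[_ + _] _; apply; [apply: xP|apply: yP].
- by move=> x xP H HP; case: (HP) => -[_ _ +] _; apply; apply: xP.
Qed.

Lemma miy_axes a b g x : miy a b g -> axes a b x -> axes a b (g x).
Proof.
have [_ mM _] := miy_subgroup a b.
move=> hg [[h hh <-]|[h hh <-]]; [left|right]; exists (h * g)%g => //; exact: mM.
Qed.

Lemma miy_stabset a b (g : aut A) : miy a b g -> g \in stabset (axes a b).
Proof.
move=> hg; apply/stabsetP; rewrite eqEsubset; split=> [_ [x Xx <-]|x Xx].
  exact: miy_axes.
exists ((g^-1)%g x); last exact: autEV.
by apply: miy_axes => //; have [_ _] := miy_subgroup a b; apply.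
Qed.

Lemma axes_axis a b x : axis a -> axis b -> axes a b x -> axis x.
Proof. by move=> aa ab [[g _ <-]|[g _ <-]]; apply: axis_aut. Qed.

Lemma axes_miy a b x : axis a -> axis b -> axes a b x -> miy a b (miyamoto x).
Proof.
move=> aa ab; have [_ mM mV] := miy_subgroup a b.
have miya : miy a b (miyamoto a) by apply: sub_gen_smallest; left.
have miyb : miy a b (miyamoto b) by apply: sub_gen_smallest; right.
by case=> -[g hg <-]; rewrite miyamotoJ //; apply: (mM) => //; apply: (mM) => //;
  apply: mV.
Qed.

Section AlgebraAxet.
Variables (a b : A) (ha : axis a) (hb : axis b).
Local Notation X := (axes a b).

Lemma axesP (x : X) : X (\val x). Proof. exact: set_valP. Qed.

Lemma stab_axes (x : X) (g : stab X) : \val g (\val x) \in X.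
Proof.
apply/mem_set; case: g => g /= /stabsetP gX.
have : (g @` X) (g (\val x)) by exists (\val x) => //; apply: axesP.
by rewrite gX.
Qed.

Definition alg_act (x : X) (g : stab X) : X := SigSub (stab_axes x g).

Definition alg_tau (x : X) : stab X :=
  Stab (miy_stabset (axes_miy ha hb (axesP x))).

Lemma alg_act1 x : alg_act x 1%g = x. Proof. exact: val_inj. Qed.

Lemma alg_actM x g h : alg_act x (g * h)%g = alg_act (alg_act x g) h.
Proof. exact: val_inj. Qed.

Lemma alg_tau_fix x : alg_act x (alg_tau x) = x.
Proof.
by apply: val_inj; apply: miyamoto_fix; apply: (axes_axis ha hb); apply: axesP.
Qed.

Lemma alg_tau2 x : (alg_tau x * alg_tau x)%g = 1%g.
Proof.
by apply: val_inj; apply: miyamoto2; apply: (axes_axis ha hb); apply: axesP.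
Qed.

Lemma alg_tauJ x g : alg_tau (alg_act x g) = (g^-1 * alg_tau x * g)%g.
Proof.
by apply: val_inj; apply: miyamotoJ; apply: (axes_axis ha hb); apply: axesP.
Qed.

(* The axet X(A) of A generated by the axes a and b. *)
Definition alg_axet : C2axet :=
  C2Axet alg_act1 alg_actM alg_tau_fix alg_tau2 alg_tauJ.

End AlgebraAxet.

End Axes.

Section TwoGenerated.
Variables (F : fieldType) (A : comAlgebra F).

Definition generated_by (a b : A) : Prop :=
  smallest (@subalgebra F A) [set a; b] = setT.

(* "Involutory" means s * s = 1. If a and b are distinct then s != 1 follows;
   if a = b, as happens for the axet X(1), s has to be allowed to be 1. *)
Definition symmetric_pair (a b : A) : Prop :=
  exists s : aut A, [/\ (s * s)%g = 1%g, s a = b & s b = a].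

End TwoGenerated.

(* The semidirect product of V and {1, -1}: Dih s k stands for the permutation
   j |-> j + k (s = false) or j |-> - j + k (s = true) of V, acting on the right.
   For V = Z/n this is the dihedral group of order 2n, for V = Z the infinite
   dihedral group. *)
Record dihedral (V : zmodType) := Dih { dih_refl : bool; dih_shift : V }.

Section Dihedral.
Variable V : zmodType.
Local Notation D := (dihedral V).

HB.instance Definition _ := gen_eqMixin D.
HB.instance Definition _ := gen_choiceMixin D.

Definition dih_act (j : V) (g : D) : V :=
  (if dih_refl g then - j else j) + dih_shift g.
Definition dih_mul (g h : D) : D :=
  Dih (dih_refl g (+) dih_refl h) (dih_act (dih_shift g) h).
Definition dih_one : D := Dih false 0.
Definition dih_inv (g : D) : D :=
  Dih (dih_refl g) (if dih_refl g then dih_shift g else - dih_shift g).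
(* j |-> 2i - j *)
Definition dih_tau (i : V) : D := Dih true (i *+ 2).

Lemma dih_mulA : associative dih_mul.
Proof.
by move=> [[] x] [[] y] [[] z]; rewrite /dih_mul/dih_act/= ?opprD ?opprK ?addrA.
Qed.
Lemma dih_mul1 : left_id dih_one dih_mul.
Proof. by move=> [[] x]; rewrite /dih_mul/dih_act/= ?oppr0 add0r. Qed.
Lemma dih_mulr1 : right_id dih_one dih_mul.
Proof. by move=> [[] x]; rewrite /dih_mul/dih_act/= addr0. Qed.
Lemma dih_mulV : left_inverse dih_one dih_inv dih_mul.
Proof. by move=> [[] x]; rewrite /dih_mul/dih_act/= addNr. Qed.
Lemma dih_mulrV : right_inverse dih_one dih_inv dih_mul.
Proof. by move=> [[] x]; rewrite /dih_mul/dih_act/= ?addNr ?subrr. Qed.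

HB.instance Definition _ :=
  isGroup.Build D dih_mulA dih_mul1 dih_mulr1 dih_mulV dih_mulrV.

Lemma dih_act1 x : dih_act x 1%g = x. Proof. exact: addr0. Qed.
Lemma dih_actM x (g h : D) : dih_act x (g * h)%g = dih_act (dih_act x g) h.
Proof.
by case: g h => [[] g] [[] h]; rewrite /dih_act/= ?opprD ?opprK ?addrA.
Qed.
Lemma dih_tau_fix x : dih_act x (dih_tau x) = x.
Proof. by rewrite /dih_act/= mulr2n addrA addNr add0r. Qed.
Lemma dih_tau2 x : (dih_tau x * dih_tau x)%g = 1%g.
Proof. by congr Dih; rewrite /dih_act/= addNr. Qed.
Lemma dih_tauJ x (g : D) :
  dih_tau (dih_act x g) = (g^-1 * dih_tau x * g)%g.
Proof.
case: g => [[] g]; congr Dih; rewrite /dih_act/= /dih_act/= mulrnDl ?mulNrn;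
  move: (x *+ 2) => y; rewrite mulr2n addrA.
  by rewrite opprD opprK [- y + g]addrC.
by rewrite opprK [g + y]addrC.
Qed.

Definition dih_axet : C2axet :=
  C2Axet dih_act1 dih_actM dih_tau_fix dih_tau2 dih_tauJ.

End Dihedral.

(* Z/nZ for n = Some m with 0 < m (Some 0 is junk), and Z for n = None, which
   stands for n = infinity. *)
Definition polygon (n : option nat) : zmodType :=
  if n is Some m then 'I_m.-1.+1 : zmodType else int : zmodType.

(* The axet X(n), for n = 1, 2, ..., infinity. *)
Definition axetX (n : option nat) : C2axet := dih_axet (polygon n).

(* Main.v *)
From HB Require Import structures.
Require Import Defs.
From mathcomp Require Import all_boot all_order all_algebra all_field.
From mathcomp Require Import ring.
From mathcomp Require Import boolp classical_sets.

(** All the required algebras are built by one construction, a form of the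
    Highwater algebra, with (alpha, beta) = (2, 1/2).

    Over an abelian group V the Highwater algebra has spanning elements a_i and
    s_i = s_(-i), for i in V, with s_0 = 0 and
      - a_i a_j = 1/2 (a_i + a_j) + s_(i-j),
      - a_i s_j = - 3/4 a_i + 3/8 (a_(i+j) + a_(i-j)) + 3/2 s_j,
      - s_i s_j = 3/4 (s_i + s_j) - 3/8 (s_(i+j) + s_(i-j)).
    These formulas only involve the group structure of V, which is why V = Z and
    V = Z/n can be treated at once. Let R be the group algebra of V, with basis
    t^i, involution x' induced by t^i -> t^(-i) and augmentation eps, and read
    a_i as t^i and s_j as - 3/8 (t^j + t^(-j) - 2). The algebra is then R + J, where
    J is the space of x in R with x' = x and eps(x) = 0, and its product sends
    (x, u), (y, v) to the pair with components
      - 1/2 (eps(y) x + eps(x) y) - x v - u y,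
      - - 3/8 (x y' + x' y - 2 eps(x) eps(y)) + 3/2 (eps(x) v + eps(y) u) + u v.
    In this form everything about the axis a_0 = (1, 0) can be read off. Its
    eigenspaces for 1, 0, 2 and 1/2 consist of the (c, 0) with c a scalar, the
    (y, y/2) and the (y, -3/2 y) with y in J, and the (y, 0) with y' = -y; the fusion
    law follows by multiplying such pairs (eig_coordsP, fusion_hw_one). Moreover, for
    each i the map (x, u) -> (t^i x', u) is an automorphism, which exchanges a_j
    with a_(i-j): for i = 0 it is the Miyamoto involution of a_0. So all a_i are
    axes, and the Miyamoto involution of a_i sends a_j to a_(2i-j).

    The group algebra enters only through R, the involution and the augmentation,
    so it may be replaced by the ring of functions on any finite set T of characters
    of V which is closed under inversion and contains the trivial character: t^i
    becomes evaluation at i, x' becomes composition with the inversion, and eps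
    becomes evaluation at the trivial character. Identities then hold as soon as
    they hold pointwise. The resulting algebra is a quotient of the Highwater algebra
    in which the a_i stay distinct when T contains a faithful character e, and
    T = {1, e, 1/e} suffices. For Z the character is i -> 2^i, for Z/n it is given by
    a primitive n-th root of unity, so that the complex algebraic numbers can serve
    as the field in all cases.

    Finally let V be cyclic with generator g. A subset of V that contains 0 and g
    and contains 2i - j together with i and j is all of V (cyclic_refl_ind). This
    shows that the orbits of a_0 and a_g under their Miyamoto involutions contain
    every a_i, and also that every a_i lies in the subalgebra generated by a_0 and
    a_g, since a_(2i-j) can be computed from a_i and a_j. *)

Set Implicit Arguments.
Unset Strict Implicit.
Unset Printing Implicit Defensive.

Import Order.TTheory GRing.Theory Num.Theory.
Local Open Scope ring_scope.
Local Open Scope classical_set_scope.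

(** * Cyclic groups and their characters *)

Definition generates (V : zmodType) (g : V) : Prop :=
  forall i, exists k, i = g *+ k \/ i = - (g *+ k).

(** The induction step produces the multiples of g in consecutive pairs, as
    (k + 2) g = 2 (k + 1) g - k g; reflecting them in 0 gives their opposites. *)
Lemma cyclic_refl_ind (V : zmodType) (g : V) (P : V -> Prop) :
  generates g -> P 0 -> P g ->
  (forall i j, P i -> P j -> P (i *+ 2 - j)) -> forall i, P i.
Proof.
move=> V_cyclic P0 Pg Prefl.
have Pk k : P (g *+ k) /\ P (g *+ k.+1).
  elim: k => [|k [Pk PSk]]; first by rewrite mulr0n mulr1n.
  split=> //; have := Prefl _ _ PSk Pk.
  by rewrite mulr2n -addrA [X in _ + (X - _)]mulrS addrK -mulrSr.
move=> i; have [k [->|->]] := V_cyclic i; first by case: (Pk k).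
by have := Prefl _ _ P0 (Pk k).1; rewrite mul0rn sub0r.
Qed.

Section Characters.
Variables (F : fieldType) (V : zmodType).
Implicit Types (c d : V -> F) (i j : V).

Definition character c : Prop :=
  c 0 = 1 /\ {morph c : i j / i + j >-> i * j}.

Lemma character_neq0 c i : character c -> c i != 0.
Proof.
case=> c0 cD; apply/eqP=> ci0; have /eqP := cD i (- i).
by rewrite subrr c0 ci0 mul0r oner_eq0.
Qed.

Lemma characterN c i : character c -> c (- i) = (c i)^-1.
Proof.
move=> cc; have [c0 cD] := cc; apply: (mulfI (character_neq0 i cc)).
by rewrite -cD subrr c0 divff ?character_neq0.
Qed.

Lemma character_one : character (fun=> 1 : F).
Proof. by split=> // i j; rewrite mulr1. Qed.

Lemma character_inv c : character c -> character (fun i => (c i)^-1).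
Proof. by case=> c0 cD; split=> [|i j]; rewrite ?c0 ?invr1 ?cD ?invfM. Qed.

Lemma character_ext c d g : generates g -> character c -> character d ->
  c g = d g -> c = d.
Proof.
move=> V_cyclic cc dc cdg; apply: funext; have [[c0 cD] [d0 dD]] := (cc, dc).
apply: (cyclic_refl_ind V_cyclic) => [||i j cdi cdj]; first by rewrite c0 d0.
  by [].
by rewrite !mulr2n !cD !dD !characterN ?cdi ?cdj.
Qed.

End Characters.

(** * The algebra *)

Section Highwater.
(* T stands for a set of characters, o for the trivial one. *)
Variables (F : numFieldType) (T : finType) (o : T) (inv : T -> T).
Hypotheses (invK : involutive inv) (inv_o : inv o = o).

Local Notation R := {ffun T -> F^o}.

Definition even_second : {pred R * R} :=
  [pred p : R * R | (p.2 o == 0) && [forall z, p.2 (inv z) == p.2 z]].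

Lemma even_second_closed : GRing.submod_closed even_second.
Proof.
split; first by rewrite inE !ffunE eqxx /=; apply/forallP=> z; rewrite !ffunE.
move=> c p q /andP[/eqP p0 /forallP pe] /andP[/eqP q0 /forallP qe].
rewrite inE !ffunE p0 q0 scaler0 addr0 eqxx /=; apply/forallP=> z.
by rewrite !ffunE (eqP (pe z)) (eqP (qe z)).
Qed.

(** The space R + J, as a subspace of R * R so that every identity in it reduces to
    the pointwise comparison of two pairs of functions. *)
Record hw := Hw { hw_val : R * R; _ : hw_val \in even_second }.

HB.instance Definition _ := [isSub for hw_val].
HB.instance Definition _ := [Choice of hw by <:].
HB.instance Definition _ :=
  GRing.SubChoice_isSubLmodule.Build F (R * R)%type even_second hw
    (GRing.submod_closed_semi even_second_closed).

Definition fstc (p : hw) (z : T) : F := (\val p).1 z.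
Definition sndc (p : hw) (z : T) : F := (\val p).2 z.

Lemma sndc_o p : sndc p o = 0.
Proof. by case: p => p pJ; have /andP[/eqP] := pJ. Qed.

Lemma sndc_inv p z : sndc p (inv z) = sndc p z.
Proof. by case: p => p pJ; have /andP[_ /forallP/(_ z)/eqP] := pJ. Qed.

Lemma hw_ext p q : fstc p =1 fstc q -> sndc p =1 sndc q -> p = q.
Proof.
case: p q => [[x u] hp] [[y v] hq] xy uv; apply: val_inj => /=.
by congr pair; apply/ffunP; [apply: xy|apply: uv].
Qed.

Lemma hw_mk_subproof x u (u_o : u o = 0) (u_inv : forall z, u (inv z) = u z) :
  ([ffun z => x z], [ffun z => u z]) \in even_second.
Proof.
rewrite inE /= ffunE u_o eqxx /=.
by apply/forallP=> z; rewrite !ffunE u_inv.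
Qed.

Definition hw_mk x u u_o u_inv : hw := Hw (@hw_mk_subproof x u u_o u_inv).

Lemma fstc_mk x u u_o u_inv : fstc (@hw_mk x u u_o u_inv) = x.
Proof. by apply: funext => z; rewrite /fstc /= ffunE. Qed.
Lemma sndc_mk x u u_o u_inv : sndc (@hw_mk x u u_o u_inv) = u.
Proof. by apply: funext => z; rewrite /sndc /= ffunE. Qed.
Lemma fstcD p q z : fstc (p + q) z = fstc p z + fstc q z.
Proof. by rewrite /fstc raddfD /= !ffunE. Qed.
Lemma sndcD p q z : sndc (p + q) z = sndc p z + sndc q z.
Proof. by rewrite /sndc raddfD /= !ffunE. Qed.
Lemma fstcZ c p z : fstc (c *: p) z = c * fstc p z.
Proof. by rewrite /fstc linearZ /= !ffunE. Qed.
Lemma sndcZ c p z : sndc (c *: p) z = c * sndc p z.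
Proof. by rewrite /sndc linearZ /= !ffunE. Qed.
Lemma fstc0 z : fstc 0 z = 0.
Proof. by rewrite /fstc raddf0 /= !ffunE. Qed.
Lemma sndc0 z : sndc 0 z = 0.
Proof. by rewrite /sndc raddf0 /= !ffunE. Qed.

(** The components of the product of R + J, with eps(x) = x(1), and x'(z) = x(1/z). *)
Definition mul_fst p q z : F :=
  (fstc q o * fstc p z + fstc p o * fstc q z) / 2
  - fstc p z * sndc q z - sndc p z * fstc q z.
Definition mul_snd p q z : F :=
  - (3 / 8) * (fstc p z * fstc q (inv z) + fstc p (inv z) * fstc q z
               - 2 * (fstc p o * fstc q o))
  + 3 / 2 * (fstc p o * sndc q z + fstc q o * sndc p z) + sndc p z * sndc q z.

Lemma mul_snd_o p q : mul_snd p q o = 0.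
Proof. by rewrite /mul_snd inv_o !sndc_o; ring. Qed.
Lemma mul_snd_inv p q z : mul_snd p q (inv z) = mul_snd p q z.
Proof. by rewrite /mul_snd invK !sndc_inv; ring. Qed.

Definition hw_mul p q : hw :=
  hw_mk (mul_fst p q) (mul_snd_o p q) (mul_snd_inv p q).

Definition coordE := (fstcD, sndcD, fstcZ, sndcZ, fstc0, sndc0, fstc_mk, sndc_mk).

Lemma hw_mulC : commutative hw_mul.
Proof.
by move=> p q; apply: hw_ext => z; rewrite !coordE /mul_fst /mul_snd; ring.
Qed.

Lemma hw_mul_bilinear : bilinear_for *:%R *:%R hw_mul.
Proof.
have lin p : linear (hw_mul p).
  move=> c q r.
  by apply: hw_ext => z; rewrite !coordE /mul_fst /mul_snd !coordE; ring.
split=> p; last exact: lin.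
by move=> c q r /=; rewrite !(hw_mulC _ p) lin.
Qed.

HB.instance Definition _ :=
  bilinear_isBilinear.Build F hw hw hw *:%R *:%R hw_mul hw_mul_bilinear.

Definition hw_alg : comAlgebra F := @ComAlgebra F hw hw_mul hw_mulC.

(** * The axis a_0 *)

Local Notation A := hw_alg.
Local Notation ev := (@Meval F 2 (1 / 2)).

Definition hw_one : A := @hw_mk (fun=> 1) (fun=> 0) erefl (fun=> erefl).
Local Notation eigen l := (Defs.eigenspace (ev l) hw_one).

(** Solves linear equations over a field without an order: the coefficients are
    given, and what remains is a field identity. *)
Lemma linear_comb4 (c0 c1 c2 c3 h0 h1 h2 h3 x y : F) :
  h0 = 0 -> h1 = 0 -> h2 = 0 -> h3 = 0 ->
  x - y = c0 * h0 + c1 * h1 + c2 * h2 + c3 * h3 -> x = y.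
Proof.
by move=> -> -> -> ->; rewrite !mulr0 !addr0 => /subr0_eq.
Qed.

Lemma hw_one_mulE (p : A) z :
  (fstc (amul hw_one p) z = (fstc p o + fstc p z) / 2 - sndc p z) *
  (sndc (amul hw_one p) z =
     - (3 / 8) * (fstc p (inv z) + fstc p z - 2 * fstc p o) + 3 / 2 * sndc p z).
Proof.
by split; rewrite !coordE /mul_fst /mul_snd !coordE; field.
Qed.

(** The values (x(1), x(z), x(1/z), u(z)) of an eigenvector (x, u), expressed by
    x(z). *)
Definition eig_coords (l : Mlabel) (r : F) : F * F * F * F :=
  match l with
  | M1 => (r, r, r, 0)
  | M0 => (0, r, r, r / 2)
  | Malpha => (0, r, r, - (3 / 2) * r)
  | Mbeta => (0, r, - r, 0)
  end.

(** The eigenvalue equation, evaluated at z and 1/z in the first component, at the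
    trivial character in the first component and at z in the second component, is a
    linear system in x(1), x(z), x(1/z) and u(z), because u(1/z) = u(z) and u(1) = 0.
    For each of the four eigenvalues its solutions form a line. *)
Lemma eig_coordsP l (p : A) : eigen l p <->
  forall z, (fstc p o, fstc p z, fstc p (inv z), sndc p z)
            = eig_coords l (fstc p z).
Proof.
split=> [pl z|pl]; last first.
  apply: hw_ext => z; rewrite hw_one_mulE !coordE;
  have := pl z; move: (fstc p o) (fstc p (inv z)) (sndc p z) (fstc p z) => X x' u x.
    by case: l {pl} => -[]; do ![move-> | move=> _]; rewrite /=; field.
  by case: l {pl} => -[]; do ![move-> | move=> _]; rewrite /=; field.
have E1 y : (fstc p o + fstc p y) / 2 - sndc p y - ev l * fstc p y = 0.
  by apply/eqP; rewrite -hw_one_mulE -fstcZ subr_eq0 pl.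
have E2 : - (3 / 8) * (fstc p (inv z) + fstc p z - 2 * fstc p o)
    + 3 / 2 * sndc p z - ev l * sndc p z = 0.
  by apply/eqP; rewrite -hw_one_mulE -sndcZ subr_eq0 pl.
move: E2 (E1 (inv z)) (E1 z) (E1 o); rewrite sndc_o sndc_inv {pl E1}.
move: (fstc p o) (fstc p z) (fstc p (inv z)) (sndc p z) => X x y u E E' E1 E0.
have comb a b c d x' y' := @linear_comb4 a b c d _ _ _ _ x' y' E E' E1 E0.
(* Coefficients of the second component at z and of the first components at 1/z,
   at z and at the trivial character, found by elimination. *)
case: l E E' E1 E0 comb => /= E E' E1 E0 comb; congr (_, _, _, _) => //.
- by apply: (comb 1 (- 3 / 4) (2 - 3 / 4) 0); field.
- by apply: (comb 0 (- 2) 2 0); field.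
- by apply: (comb (1 / 2) (- 3 / 8) (- 3 / 8) 0); field.
- by apply: (comb 0 0 0 1); field.
- by apply: (comb 0 2 (- 2) 0); field.
- by apply: (comb 0 0 (- 1) (1 / 2)); field.
- by apply: (comb 0 0 0 (- 1)); field.
- by apply: (comb 0 (- 2 / 3) (2 / 3) 0); field.
- by apply: (comb 0 0 (- 1) (- 1 / 2)); field.
- by apply: (comb 0 0 0 2); field.
- by apply: (comb (- 8 / 3) 0 (- 8 / 3) (20 / 3)); field.
- by apply: (comb 0 0 (- 1) 1); field.
Qed.

(** Projections to the eigenspaces: with y = (x + x') / 2 - x(1) in J, the pair
    (y, u) is (p, p/2) + (q, -3/2 q) for p = 3/4 y + u/2 and q = y/4 - u/2. *)
Definition hw_comp_fst (p : A) l z : F :=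
  match l with
  | M1 => fstc p o
  | M0 => 3 / 8 * (fstc p z + fstc p (inv z) - 2 * fstc p o) + sndc p z / 2
  | Malpha => (fstc p z + fstc p (inv z) - 2 * fstc p o) / 8 - sndc p z / 2
  | Mbeta => (fstc p z - fstc p (inv z)) / 2
  end.

Definition hw_comp_snd p l z : F :=
  match l with
  | M0 => hw_comp_fst p M0 z / 2
  | Malpha => - (3 / 2) * hw_comp_fst p Malpha z
  | _ => 0
  end.

Lemma hw_comp_snd_o p l : hw_comp_snd p l o = 0.
Proof. by case: l; rewrite /= ?inv_o ?sndc_o; field. Qed.

Lemma hw_comp_snd_inv p l z : hw_comp_snd p l (inv z) = hw_comp_snd p l z.
Proof. by case: l; rewrite /= ?invK ?sndc_inv; field. Qed.

Definition hw_comp p l : A :=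
  hw_mk (hw_comp_fst p l) (hw_comp_snd_o p l) (hw_comp_snd_inv p l).

Lemma hw_comp_eig p l : eigen l (hw_comp p l).
Proof.
apply/eig_coordsP => z; rewrite !coordE.
by case: l => /=; congr (_, _, _, _); rewrite ?inv_o ?invK ?sndc_inv ?sndc_o; field.
Qed.

Lemma hw_comp_sum p : p = \sum_(l <- Mlabels) hw_comp p l.
Proof.
by rewrite /Mlabels !big_cons big_nil; apply: hw_ext => z; rewrite !coordE /=; field.
Qed.

Lemma hw_one_direct (w : Mlabel -> A) :
    (forall l, eigen l (w l)) -> \sum_(l <- Mlabels) w l = 0 ->
  forall l, w l = 0.
Proof.
move=> we; rewrite /Mlabels !big_cons big_nil => w0.
have coord0 l : fstc (w l) =1 fun=> 0.
  move=> z; have we' k := (eig_coordsP k (w k)).1 (we k) z.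
  have := congr1 (fstc^~ o) w0; have := congr1 (fstc^~ z) w0.
  have := congr1 (fstc^~ (inv z)) w0; have := congr1 (sndc^~ z) w0.
  rewrite !coordE.
  have [-> -> ->] := we' M1; have [-> -> ->] := we' M0.
  have [-> -> ->] := we' Malpha; have [-> -> ->] := we' Mbeta.
  move=> E E' E1 E0.
  have comb a b c d x' y' := @linear_comb4 a b c d _ _ _ _ x' y' E E' E1 E0.
  (* The same combinations as in the formulas for the projections. *)
  case: l.
  - by apply: (comb 0 0 0 1); field.
  - by apply: (comb (1 / 2) (3 / 8) (3 / 8) (- 3 / 4)); field.
  - by apply: (comb (- 1 / 2) (1 / 8) (1 / 8) (- 1 / 4)); field.
  - by apply: (comb 0 (- 1 / 2) (1 / 2) 0); field.
move=> l; apply: hw_ext => z; rewrite coordE; first exact: coord0.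
have /(congr1 snd) /= := (eig_coordsP l (w l)).1 (we l) z; rewrite coord0 => ->.
by case: l; rewrite /= ?mul0r ?mulr0.
Qed.

Lemma fusion_hw_one l m (v v' : A) :
  eigen l v -> eigen m v' ->
  amul v v' = \sum_(k <- Mstar l m) hw_comp (amul v v') k.
Proof.
move=> /eig_coordsP ve /eig_coordsP ve'.
apply: hw_ext => z; have := ve z; have := ve' z;
case: l m {ve ve'} => -[]; rewrite /= ?big_cons ?big_nil !coordE /= ?coordE
  /mul_fst /mul_snd ?inv_o ?invK ?sndc_inv ?sndc_o;
move: (fstc v o) (fstc v' o) (fstc v z) (fstc v' z) (fstc v (inv z))
  (fstc v' (inv z)) (sndc v z) (sndc v' z) => X Y x y x' y' u w;
by move=> E' E; case: E; do ![move-> | move=> _];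
  case: E'; do ![move-> | move=> _]; field.
Qed.

Lemma hw_one_axis : axis 2 (1 / 2) hw_one.
Proof.
split.
- have /eig_coordsP : forall z, (fstc hw_one o, fstc hw_one z, fstc hw_one (inv z),
      sndc hw_one z) = eig_coords M1 (fstc hw_one z) by move=> z; rewrite !coordE.
  by rewrite /Defs.eigenspace /= scale1r.
- rewrite eqEsubset; split=> // p _; exists (hw_comp p); last exact: hw_comp_sum.
  exact: hw_comp_eig.
- exact: hw_one_direct.
- move=> l m v v' vl vm; exists (hw_comp (amul v v')); first exact: hw_comp_eig.
  exact: fusion_hw_one.
Qed.

(** * Reflections and the axes a_i *)

(* chi z is the character z. *)
Variables (V : zmodType) (chi : T -> V -> F).
Hypothesis chi_char : forall z, character (chi z).
Hypothesis chi_inv : forall z i, chi (inv z) i = (chi z i)^-1.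
Hypothesis chi_o : forall i, chi o i = 1.

Lemma chi0 z : chi z 0 = 1.
Proof. by case: (chi_char z). Qed.

Lemma chiD z i j : chi z (i + j) = chi z i * chi z j.
Proof. by case: (chi_char z). Qed.

Lemma chiN z i : chi z (- i) = (chi z i)^-1.
Proof. exact: characterN. Qed.

Lemma chi_neq0 z i : chi z i != 0.
Proof. exact: character_neq0. Qed.

Definition hw_fst (x : T -> F) : A := @hw_mk x (fun=> 0) erefl (fun=> erefl).

Definition hw_ax (i : V) : A := hw_fst (chi^~ i).

Lemma hw_ax0 : hw_ax 0 = hw_one.
Proof. by apply: hw_ext => z; rewrite !coordE ?chi0. Qed.

(** The map (x, u) -> (t^i x', u). These reflections are all the symmetries that are
    needed: the one for i sends a_0 to a_i, the one for 0 is the Miyamoto involution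
    of a_0, and the one for a generator g of V exchanges a_0 and a_g. *)
Definition hw_refl_fun i (p : A) : A :=
  hw_mk (fun z => chi z i * fstc p (inv z)) (sndc_o p) (sndc_inv p).

Lemma hw_refl_linear i : linear (hw_refl_fun i).
Proof.
by move=> c p q; apply: hw_ext => z; rewrite !coordE; ring.
Qed.

Lemma hw_refl_morph i : {morph hw_refl_fun i : p q / amul p q}.
Proof.
move=> p q; apply: hw_ext => z; rewrite !coordE /mul_fst /mul_snd !coordE
  ?invK ?inv_o ?sndc_inv ?chi_inv ?chi_o;
  by field; rewrite ?chi_neq0.
Qed.

Lemma hw_reflK i : involutive (hw_refl_fun i).
Proof.
move=> p; apply: hw_ext => z; rewrite !coordE // invK chi_inv;
  by field; rewrite ?chi_neq0.
Qed.

Definition hw_refl i : aut A :=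
  Aut (@hw_refl_linear i) (@hw_refl_morph i) (Bijective (hw_reflK i) (hw_reflK i)).

Lemma hw_refl_ax i j : hw_refl i (hw_ax j) = hw_ax (i - j).
Proof.
by apply: hw_ext => z; rewrite !coordE // chiD chiN chi_inv.
Qed.

Lemma hw_refl_axV i j : ((hw_refl i)^-1)%g (hw_ax j) = hw_ax (i - j).
Proof. by rewrite -{1}(subKr i j) -hw_refl_ax autVE. Qed.

Lemma miyamoto_hw_one : miyamoto 2 (1 / 2) hw_one = hw_refl 0.
Proof.
apply/esym/miyamoto_unique; first exact: hw_one_axis.
have refl0 l v : eigen l v -> hw_refl 0 v = Msign F l *: v.
  move=> /eig_coordsP ve; apply: hw_ext => z; have := ve z;
  rewrite !coordE ?chi0; case: l {ve} => -[] /=;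
  by do ![move-> | move=> _]; ring.
by split=> v ve; [rewrite (refl0 Mbeta) ?scaleN1r | rewrite (refl0 M1) ?scale1r
  | rewrite (refl0 M0) ?scale1r | rewrite (refl0 Malpha) ?scale1r].
Qed.

Lemma hw_ax_refl i : hw_ax i = hw_refl i hw_one.
Proof. by rewrite -hw_ax0 hw_refl_ax subr0. Qed.

Lemma hw_ax_axis i : axis 2 (1 / 2) (hw_ax i).
Proof. by rewrite hw_ax_refl; apply/axis_aut/hw_one_axis. Qed.

Lemma miyamoto_hw_ax i j :
  miyamoto 2 (1 / 2) (hw_ax i) (hw_ax j) = hw_ax (i *+ 2 - j).
Proof.
rewrite hw_ax_refl miyamotoJ ?miyamoto_hw_one; last exact: hw_one_axis.
rewrite !autME hw_refl_axV !hw_refl_ax; congr hw_ax.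
by rewrite sub0r opprK addrA.
Qed.

(** * Generation *)

Section Subalgebra.
Variables (B : set A) (sB : subalgebra B).

Lemma subalgD p q : B p -> B q -> B (p + q).
Proof. by case: sB => _ lB _ Bp Bq; rewrite -(scale1r p); apply: lB. Qed.

Lemma subalgZ c p : B p -> B (c *: p).
Proof. by case: sB => B0 lB _ Bp; rewrite -(addr0 (c *: p)); apply: lB. Qed.

Lemma subalg_sum I (r : seq I) (P : pred I) (f : I -> A) :
  (forall i, P i -> B (f i)) -> B (\sum_(i <- r | P i) f i).
Proof. by case: sB => B0 _ _ Bf; apply: big_ind => //; apply: subalgD. Qed.

Lemma subalgM p q : B p -> B q -> B (amul p q).
Proof. by case: sB => _ _; apply. Qed.

(** The product a_i a_j yields s = s_(i-j), and a_i s - 3/2 s has second component 0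
    and first component - t^i s = 3/8 (a_(2i-j) + a_j - 2 a_i). *)
Lemma subalg_ax_refl i j : B (hw_ax i) -> B (hw_ax j) -> B (hw_ax (i *+ 2 - j)).
Proof.
move=> Bi Bj; pose s : A := amul (hw_ax i) (hw_ax j)
  + (- (1 / 2)) *: (hw_ax i + hw_ax j).
have Bs : B s by apply: subalgD; [apply: subalgM|apply: subalgZ; apply: subalgD].
suff -> : hw_ax (i *+ 2 - j) = (8 / 3) *: (amul (hw_ax i) s + (- (3 / 2)) *: s)
    + ((- 1) *: hw_ax j + 2 *: hw_ax i).
  by do ![exact: Bs|exact: Bi|exact: Bj|apply: subalgD|apply: subalgZ|apply: subalgM].
apply: hw_ext => z; rewrite /s !coordE /mul_fst /mul_snd !coordE /mul_fst /mul_snd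
  !coordE ?chi_inv ?chi_o ?mulr2n ?chiD ?chiN;
  by field; rewrite ?chi_neq0.
Qed.

End Subalgebra.

Variable g : V.
Hypothesis V_cyclic : generates g.
Hypothesis chi_sep : injective (chi^~ g).
Hypothesis chi_faithful : forall i j, (forall z, chi z i = chi z j) -> i = j.

Lemma hw_fst_sum I (r : seq I) (P : pred I) (f : I -> A) z :
  (fstc (\sum_(i <- r | P i) f i) z = \sum_(i <- r | P i) fstc (f i) z)
  * (sndc (\sum_(i <- r | P i) f i) z = \sum_(i <- r | P i) sndc (f i) z).
Proof.
split.
  by apply: (big_morph (fun p : A => fstc p z)) => [p q|]; rewrite !coordE.
by apply: (big_morph (fun p : A => sndc p z)) => [p q|]; rewrite !coordE.
Qed.

(** The a_i span all (x, 0): their span is closed under multiplication by t^g - c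
    for every scalar c, and as the characters in T are separated by their values at
    g, products of such factors are nonzero multiples of the indicator functions
    (Lagrange interpolation). For u in J, the product of a_0 and (u, 0) is
    (u/2, -3/4 u), which provides the second component. *)
Lemma hw_generated : generated_by (hw_ax 0) (hw_ax g).
Proof.
rewrite /generated_by eqEsubset; split=> // p _ B [sB subB].
have Bax : forall i, B (hw_ax i).
  apply: (cyclic_refl_ind V_cyclic); [by apply: subB; left|by apply: subB; right|].
  exact: (subalg_ax_refl sB).
pose Q x := forall i, B (hw_fst (fun z => chi z i * x z)).
have Qmul c x : Q x -> Q (fun z => (chi z g - c) * x z).
  move=> Qx i; suff -> : hw_fst (fun z => chi z i * ((chi z g - c) * x z)) =
      hw_fst (fun z => chi z (i + g) * x z)
      + (- c) *: hw_fst (fun z => chi z i * x z).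
    by apply: (subalgD sB) => //; apply: (subalgZ sB).
  by apply: hw_ext => z; rewrite !coordE ?chiD; ring.
have Qprod (r : seq T) (P : pred T) :
    Q (fun z => \prod_(w <- r | P w) (chi z g - chi w g)).
  elim: r => [|w r IHr].
    move=> i; rewrite (_ : hw_fst _ = hw_ax i); first exact: Bax.
    by apply: hw_ext => z; rewrite !coordE ?big_nil ?mulr1.
  have [Pw|Pw] := boolP (P w); last first.
    by under eq_fun do rewrite big_cons (negbTE Pw).
  by under eq_fun do rewrite big_cons Pw; apply: Qmul.
have Bfst x : B (hw_fst x).
  pose d w z := \prod_(w' | w' != w) (chi z g - chi w' g).
  have dw w : d w w != 0.
    apply/prodf_neq0 => w' w'w; rewrite subr_eq0; apply: contra w'w.
    by move=> /eqP /chi_sep ->.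
  have -> : hw_fst x = \sum_w (x w / d w w) *: hw_fst (d w).
    apply: hw_ext => z; rewrite hw_fst_sum !coordE; last first.
      by rewrite big1 // => w _; rewrite !coordE mulr0.
    rewrite (bigD1 z) //= big1 => [|w wz]; rewrite !coordE.
      by rewrite addr0 divfK.
    by rewrite [d w z](bigD1 z) 1?eq_sym //= subrr mul0r mulr0.
  apply: (subalg_sum sB) => w _; apply: (subalgZ sB).
  have := Qprod (index_enum T) (fun w' => w' != w) 0.
  by under eq_fun do rewrite chi0 mul1r.
have -> : p = hw_fst (fun z => fstc p z + 2 / 3 * sndc p z)
    + (- (4 / 3)) *: amul hw_one (hw_fst (sndc p)).
  apply: hw_ext => z; rewrite !coordE /mul_fst /mul_snd !coordE ?sndc_inv ?sndc_o;
  by field.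
apply: (subalgD sB) => //; apply: (subalgZ sB); apply: (subalgM sB) => //.
by rewrite -hw_ax0.
Qed.

Lemma hw_symmetric : symmetric_pair (hw_ax 0) (hw_ax g).
Proof.
exists (hw_refl g); split; rewrite ?hw_refl_ax ?subr0 ?subrr //.
by apply: autP => p; rewrite autME aut1E; apply: hw_reflK.
Qed.

Lemma hw_ax_inj : injective hw_ax.
Proof.
move=> i j ij; apply: chi_faithful => z.
by have := congr1 (fstc^~ z) ij; rewrite !coordE.
Qed.

(** The automorphisms f such that f and its inverse map the set of all a_i to itself
    form a subgroup, which contains the Miyamoto involutions of a_0 and a_g. *)
Lemma hw_miy_ax f i : miy 2 (1 / 2) (hw_ax 0) (hw_ax g) f ->
  exists j, f (hw_ax i) = hw_ax j.
Proof.
pose H := [set h : aut A | forall i, (exists j, h (hw_ax i) = hw_ax j)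
  /\ (exists j, (h^-1)%g (hw_ax i) = hw_ax j)].
suff sH : miy 2 (1 / 2) (hw_ax 0) (hw_ax g) `<=` H.
  by move=> /sH /(_ i)[].
have miyH k : H (miyamoto 2 (1 / 2) (hw_ax k)).
  move=> j; split; exists (k *+ 2 - j); first exact: miyamoto_hw_ax.
  have /esym := miyamoto_hw_ax k (k *+ 2 - j); rewrite subKr => jE.
  by rewrite [in LHS]jE autVE.
apply: smallest_sub => [|_ [] ->]; try exact: miyH.
split=> [k|x y Hx Hy k|x Hx k].
- by split; exists k; rewrite ?invg1 aut1E.
- split.
    have [[j xj] _] := Hx k; have [[j' yj] _] := Hy j.
    by exists j'; rewrite autME xj.
  have [_ [j yj]] := Hy k; have [_ [j' xj]] := Hx j.
  by exists j'; rewrite invgM autME yj.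
- by rewrite invgK; have [] := Hx k.
Qed.

Lemma hw_axes : axes 2 (1 / 2) (hw_ax 0) (hw_ax g) = range hw_ax.
Proof.
rewrite eqEsubset; split=> [_ [] [f hf <-]|_ [i _ <-]].
- by have [j ->] := hw_miy_ax 0 hf; exists j.
- by have [j ->] := hw_miy_ax g hf; exists j.
have [miy1 _ _] := miy_subgroup 2 (1 / 2) (hw_ax 0) (hw_ax g).
move: i; apply: (cyclic_refl_ind V_cyclic); [by left; exists 1%g|by right; exists 1%g|].
move=> i j ai aj; rewrite -miyamoto_hw_ax; apply: miy_axes => //.
by apply: axes_miy => //; apply: hw_ax_axis.
Qed.

Lemma hw_axet_iso :
  axet_iso (alg_axet (hw_ax_axis 0) (hw_ax_axis g)) (dih_axet V).
Proof.
have axP i : hw_ax i \in axes 2 (1 / 2) (hw_ax 0) (hw_ax g).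
  by apply/mem_set; rewrite hw_axes; exists i.
have idx (x : alg_axet (hw_ax_axis 0) (hw_ax_axis g)) :
    exists i, hw_ax i = \val x.
  by have [i _ ix] : range hw_ax (\val x) by [rewrite -hw_axes; apply: axesP]; exists i.
pose psi x := sval (cid (idx x)).
have psiK x : hw_ax (psi x) = \val x by rewrite /psi; case: cid.
exists psi.
  exists (fun i => SigSub (axP i)) => [x|i]; first exact/val_inj/psiK.
  by apply: hw_ax_inj; rewrite psiK.
move=> x y; apply: hw_ax_inj; rewrite psiK /= -!psiK miyamoto_hw_ax.
by rewrite /dih_act /= addrC.
Qed.

End Highwater.

(** * The axet X(n) *)

(** The trivial character, e and 1/e already form a suitable set T: e alone keeps
    the axes apart, and characters of V are determined by their values at g. *)
Lemma axial_of_character (F : numFieldType) (V : zmodType) (g : V) (e : V -> F) :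
  generates g -> character e -> injective e ->
  exists (A : comAlgebra F) (a b : A)
         (ha : axis 2 (1 / 2) a) (hb : axis 2 (1 / 2) b),
    [/\ generated_by a b, symmetric_pair a b
      & axet_iso (alg_axet ha hb) (dih_axet V)].
Proof.
move=> V_cyclic ec e_inj.
(* If the square of e is trivial, entries coincide; the type seq_sub s identifies
   them, so that evaluation at g is injective on it. *)
pose s : seq (V -> F) := [:: fun=> 1; e; fun i => (e i)^-1].
pose invf (c : V -> F) i := (c i)^-1.
have invfK c : invf (invf c) = c by apply: funext => i; rewrite /invf invrK.
have s_inv c : c \in s -> invf c \in s.
  rewrite !inE => /or3P[]/eqP->.
  - by apply/or3P/Or31/eqP/funext => i; rewrite /invf invr1.
  - by apply/or3P/Or33/eqP.
  - by apply/or3P/Or32/eqP; apply: invfK.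
have s_char c : c \in s -> character c.
  rewrite !inE => /or3P[]/eqP-> //; first exact: character_one.
  exact: character_inv.
have s_one : (fun=> 1) \in s by rewrite inE eqxx.
have s_e : e \in s by rewrite !inE eqxx orbT.
pose inv (z : seq_sub s) : seq_sub s := SeqSub (s_inv _ (ssvalP z)).
have invK : involutive inv by move=> z; apply: val_inj; apply: invfK.
pose o : seq_sub s := SeqSub s_one.
have inv_o : inv o = o.
  by apply: val_inj; apply: funext => i; rewrite /= /invf invr1.
pose chi (z : seq_sub s) : V -> F := ssval z.
have chi_char z : character (chi z) by apply/s_char/ssvalP.
have chi_inv z i : chi (inv z) i = (chi z i)^-1 by [].
have chi_o i : chi o i = 1 by [].
have chi_sep : injective (chi^~ g).
  move=> z w zw; apply: val_inj.
  exact: (character_ext V_cyclic (chi_char z) (chi_char w) zw).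
have chi_faithful i j : (forall z, chi z i = chi z j) -> i = j.
  by move=> /(_ (SeqSub s_e)) /e_inj.
exists (hw_alg F invK inv_o), (hw_ax invK inv_o chi 0), (hw_ax invK inv_o chi g).
exists (hw_ax_axis invK inv_o chi_char chi_inv chi_o 0).
exists (hw_ax_axis invK inv_o chi_char chi_inv chi_o g).
split.
- exact: hw_generated.
- exact: hw_symmetric.
- exact: hw_axet_iso.
Qed.

Lemma polygon_character (n : option nat) : n <> Some 0%N ->
  exists (g : polygon n) (e : polygon n -> algC),
    [/\ generates g, character e & injective e].
Proof.
case: n => [[//|n]|] _ /=.
  have [z z_prim] := C_prim_root_exists (ltn0Sn n).
  (* In Z/1 the generator is 0, so that the two generating axes coincide. *)
  exists (inZp 1), (fun i : 'I_n.+1 => z ^+ i); split.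
  - move=> i; exists i; left; apply: val_inj.
    by rewrite Zp_mulrn /= modnMml mul1n modn_small.
  - split=> [|i j]; first exact: expr0.
    by rewrite /= prim_expr_mod // exprD.
  - move=> i j /eqP; rewrite (eq_prim_root_expr z_prim) !modn_small // => /eqP.
    exact: val_inj.
exists 1, (fun i : int => 2 ^ i); split.
- move=> i; exists `|i|%N; case: i => k; [left|right]; rewrite ?NegzE /=.
    by rewrite natz.
  by rewrite natz.
- by split=> [|i j]; rewrite ?expr0z // expfzDr // pnatr_eq0.
- move=> i j; have rati k : (2 : algC) ^ k = ratr (2 ^ k).
    by rewrite rmorphXz /= ?ratr_nat // unitfE.
  by rewrite !rati => /fmorph_inj; apply: ieexprIz.
Qed.

Lemma uniq_eigenvalues (F : numFieldType) : uniq [:: 1; 0; 2; 1 / 2 : F].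
Proof.
have lt12 : (1 : F) < 2 by rewrite ltr1n.
have half_lt1 : 1 / 2 < 1 :> F by rewrite ltr_pdivrMr ?mul1r ?ltr0n.
have half_gt0 : 0 < 1 / 2 :> F by rewrite divr_gt0 ?ltr0n.
rewrite /= !inE !negb_or oner_eq0 (lt_eqF lt12) (gt_eqF half_lt1).
rewrite (lt_eqF half_gt0) (gt_eqF (lt_trans half_lt1 lt12)).
by rewrite lt_eqF ?ltr0n.
Qed.

Theorem theorem1p4 (n : option nat) (n_pos : n <> Some 0%N) :
  exists (F : fieldType) (alpha beta : F) (A : comAlgebra F) (a b : A)
         (ha : axis alpha beta a) (hb : axis alpha beta b),
    [/\ 2%:R != 0 :> F,
        uniq [:: 1; 0; alpha; beta],
        generated_by a b,
        symmetric_pair a b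
      & axet_iso (alg_axet ha hb) (axetX n)].
Proof.
have [g [e [V_cyclic ec e_inj]]] := polygon_character n_pos.
have [A [a [b [ha [hb [gen sym iso]]]]]] := axial_of_character V_cyclic ec e_inj.
exists algC, 2, (1 / 2), A, a, b, ha, hb; split=> //; first by rewrite pnatr_eq0.
exact: uniq_eigenvalues.
Qed.
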